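(* For every infinite ultrametric space $(X,d)$ there exists a countably infinite subset $Y$ of $X$ such that every free ultrafilter $\mathcal{U}$ on $X$ satisfying $Y\in\mathcal{U}$ is metrically Ramsey.
   Context: An ultrametric space is a metric space $(X,d)$ such that $d(x,y)\leq\max\{d(x,z),d(z,y)\}$ for all $x,y,z\in X$. $[X]^2$ denotes the set of all two-element subsets of $X$. For a metric space $(X,d)$, a mapping $\chi:[X]^2\to\{0,1\}$ is an isometric coloring if $d(x,y)=d(z,t)$ implies $\chi(\{x,y\})=\chi(\{z,t\})$ for all $\{x,y\},\{z,t\}\in[X]^2$. For $U\subseteq X$, the set $[U]^2$ is $\chi$-monochrome if $\chi$ is constant on $[U]^2$. A free (i.e. non-principal) ultrafilter $\mathcal{U}$ on an infinite metric space $(X,d)$ is metrically Ramsey if for every isometric coloring $\chi$ of $[X]^2$ there is $U\in\mathcal{U}$ such that $[U]^2$ is $\chi$-monochrome. *)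

(* Defs.v *)
From mathcomp Require Import all_boot all_order all_algebra.
From mathcomp Require Import boolp classical_sets functions cardinality.
From mathcomp Require Import reals filter topology metric_structure.

Set Implicit Arguments.
Unset Strict Implicit.
Unset Printing Implicit Defensive.

Import Order.TTheory GRing.Theory Num.Theory.

Local Open Scope classical_set_scope.
Local Open Scope card_scope.
Local Open Scope ring_scope.

Definition ultrametric (R : realType) (X : metricType R) : Prop :=
  forall x y z : X, mdist x y <= Num.max (mdist x z) (mdist z y).

(* [U]^2 *)
Definition two_subsets (X : Type) (U : set X) : set (set X) :=
  [set A | A `<=` U /\ A #= `I_2].

(* A coloring of [X]^2 is encoded as a total function on [set X]; its values
   outside of [two_subsets setT] are never used. *)
Definition isometric_coloring (R : realType) (X : metricType R)
    (chi : set X -> bool) : Prop :=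
  forall x y z t : X,
    two_subsets [set: X] [set x; y] -> two_subsets [set: X] [set z; t] ->
    mdist x y = mdist z t -> chi [set x; y] = chi [set z; t].

Definition monochrome (X : Type) (chi : set X -> bool) (U : set X) : Prop :=
  forall A B : set X, two_subsets U A -> two_subsets U B -> chi A = chi B.

Definition free_ultrafilter (X : Type) (F : set_system X) : Prop :=
  UltraFilter F /\ ~ exists x : X, F = principal_filter x.

Definition metrically_Ramsey (R : realType) (X : metricType R)
    (F : set_system X) : Prop :=
  forall chi : set X -> bool, isometric_coloring chi ->
    exists2 U : set X, F U & monochrome chi U.

(* Main.v *)
Require Import Defs.
From mathcomp Require Import all_boot all_order all_algebra.
From mathcomp Require Import boolp classical_sets functions cardinality.
From mathcomp Require Import reals filter topology metric_structure.

Import Order.TTheory.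

Local Open Scope classical_set_scope.

(** If infinitely many distances [d(x, y)] from some point [x] occur, choose
    points [s n] at pairwise distinct distances from [x]; by the ultrametric
    inequality [d(s i, s j)] is [d(s i, x)] or [d(s j, x)].  Otherwise every
    infinite set meets some sphere around each of its points in an infinite
    set, and iterating yields points with [d(s i, s j) = d(s i, s i.+1)] for
    [i < j].  In both cases there are points [p n] such that [d(s i, s j)] is
    [d(s i, p i)] or [d(s j, p j)], so every isometric coloring is constant on
    the pairs of [s n]'s for which [{s n, p n}] has a given color; an
    ultrafilter containing the range of [s] contains one of these two sets. *)

Lemma two_subsetsP (T : Type) (U A : set T) :
  two_subsets U A <-> exists x y, [/\ U x, U y, x <> y & A = [set x; y]].
Proof.
split=> [[AU /eq_cardSP[x Ax /eq_cardSP[y [Ay yx]]]]|[x [y [Ux Uy xy ->]]]].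
  rewrite II0 card_eq0 => /eqP A0; exists x, y.
  split; [exact: AU|exact: AU|by move=> /esym|].
  apply/seteqP; split=> [z Az|z [->|->]//].
  apply: contrapT => /not_orP[zx zy].
  by have : set0 z by rewrite -A0.
split=> [z [->|->]//|].
apply/eq_cardSP; exists x; first by left.
suff -> : [set x; y] `\ x = [set y] by exact: card_set1.
apply/seteqP; split=> [z [[//|->//]]|z ->].
by split; [right|exact/nesym].
Qed.

Lemma exists_seq (T : Type) (A : set T) :
  infinite_set A -> exists2 f : nat -> T, injective f & forall n, A (f n).
Proof.
move=> /infiniteP/card_leP[f].
have inT n : n \in [set: nat] by rewrite in_setT.
exists (fun n => set_val (f (exist _ n (inT n)))) => [m n /val_inj|n]; last first.
  exact: set_valP.
by move=> /(inj (in_setT _) (in_setT _))[].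
Qed.

Lemma range_infinite (T : Type) (s : nat -> T) :
  injective s -> infinite_set (range s).
Proof.
move=> sinj; apply/infiniteP.
by rewrite (card_le_eqr (inj_card_eq _))// => m n _ _; exact: sinj.
Qed.

Section Partners.
Variables (R : realType) (X : metricType R).

(** Only the distance from [s n] to [p n] matters, so [p n] may lie outside the range of [s];
    [s n <> p n] makes [[set s n; p n]] a pair to which an isometric coloring applies. *)
Definition partners (s p : nat -> X) : Prop :=
  (forall n, s n <> p n) /\ forall i j, (i < j)%N ->
    mdist (s i) (s j) = mdist (s i) (p i) \/
    mdist (s i) (s j) = mdist (s j) (p j).

Lemma partners_monochrome (s p : nat -> X) (chi : set X -> bool) (b : bool) :
  partners s p -> isometric_coloring chi ->
  monochrome chi (s @` [set n | chi [set s n; p n] = b]).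
Proof.
move=> [sp dsp] chi_iso.
have pairT (x y : X) : x <> y -> two_subsets setT [set x; y].
  by move=> xy; apply/two_subsetsP; exists x, y.
have chi_lt i j : (i < j)%N -> s i <> s j ->
    chi [set s i; p i] = b -> chi [set s j; p j] = b ->
    chi [set s i; s j] = b.
  by move=> ij sij <- chij; case: (dsp i j ij) => /chi_iso -> //;
    rewrite ?chij //; exact: pairT.
suff chib A : two_subsets (s @` [set n | chi [set s n; p n] = b]) A -> chi A = b.
  by move=> A B /chib -> /chib ->.
move=> /two_subsetsP[_ [_ [[i /= bi <-] [j /= bj <-] sij ->]]].
case: (ltngtP i j) => [ij|ji|ij]; first exact: chi_lt.
- by rewrite setUC; apply: chi_lt => // /esym.
- by rewrite ij in sij.
Qed.

Lemma partners_Ramsey (s p : nat -> X) (F : set_system X) :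
  partners s p -> UltraFilter F -> F (range s) -> metrically_Ramsey F.
Proof.
move=> sp FU Fs chi chi_iso.
pose U b := s @` [set n | chi [set s n; p n] = b].
have [FUt|FUt] := in_ultra_setVsetC (U true) FU.
  by exists (U true) => //; exact: partners_monochrome sp chi_iso.
exists (U false); last exact: partners_monochrome sp chi_iso.
(* Within the range of [s], the complement of [U true] lies in [U false]. *)
apply: filterS (filterI Fs FUt) => _ [[n _ <-] nUt].
by exists n => //=; apply/negP => nt; apply: nUt; exists n.
Qed.

(** In an ultrametric triangle the two longest sides are equal: with distinct sides from [x] to
    [s i] and [s j], the third side equals the larger one. So [x] can be the partner of every
    [s n]. *)
Lemma infinite_distances_partners (x : X) :
  ultrametric X -> infinite_set (range (mdist x)) ->
  exists2 s, injective s & exists p, partners s p.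
Proof.
move=> Xultra xinf.
(* Distance 0 is discarded so that [s n] differs from its partner [x]. *)
have [f finj fD] := exists_seq _ _ (infinite_setD xinf (finite_set1 0%R)).
have /choice[s xs] n : exists y, mdist x y = f n.
  by have [[y _ ?] _] := fD n; exists y.
exists s; first by move=> m n smn; apply: finj; rewrite -!xs smn.
exists (fun=> x); split=> [n snx|i j ij].
  by have [_] := fD n; apply; rewrite /= -xs snx mdistxx.
have dfij : f i != f j.
  by apply/eqP => /finj ij'; rewrite ij' ltnn in ij.
have ds n : mdist (s n) x = f n by rewrite metric_sym.
rewrite !ds.
have dsij := Xultra (s i) (s j) x.
have dxi := Xultra x (s i) (s j).
have dxj := Xultra x (s j) (s i).
rewrite (metric_sym (s j) (s i)) !xs in dxi dxj.
rewrite ds xs in dsij.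
case: (ltgtP (f i) (f j)) dfij => // fij _; [right|left]; apply/eqP.
(* Here [dsij] bounds the third side above by [f j], and [dxj] bounds it below since [f j <= f i] is
   excluded. *)
- move: dsij; rewrite (max_r (ltW fij)) eq_le => -> /=; move: dxj.
  by rewrite le_max [(_ <= f i)%R]leNgt fij.
- move: dsij; rewrite (max_l (ltW fij)) eq_le => -> /=; move: dxi.
  by rewrite le_max [(_ <= f j)%R]leNgt fij.
Qed.

(** Pigeonhole: finitely many spheres around a point of [A] cover [A]. Center and infinite piece
    form one pair so that a single choice function can be iterated. *)
Lemma infinite_sphere_inter (A : set X) :
  (forall x : X, finite_set (range (mdist x))) -> infinite_set A ->
  exists xB : X * set X, [/\ A xB.1, infinite_set xB.2, xB.2 `<=` A `\ xB.1 &
    forall y z, xB.2 y -> xB.2 z -> mdist xB.1 y = mdist xB.1 z].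
Proof.
move=> Xfin Ainf; have [x Ax] := infinite_setN0 Ainf.
have A'inf := infinite_setD Ainf (finite_set1 x).
apply: contrapT => noB; apply: A'inf.
apply: (@sub_finite_set _ _
  (\bigcup_(r in range (mdist x)) ((A `\ x) `&` [set y | mdist x y = r]))).
  by move=> y Ay; exists (mdist x y).
apply: bigcup_finite => // r _; apply: contrapT => Binf; apply: noB.
exists (x, (A `\ x) `&` [set y | mdist x y = r]); split=> //=.
by move=> y z [_ ->] [_ ->].
Qed.

Lemma finite_distances_partners :
  infinite_set [set: X] -> (forall x : X, finite_set (range (mdist x))) ->
  exists2 s, injective s & exists p, partners s p.
Proof.
move=> Xinf Xfin.
have [x0 _] := infinite_setN0 Xinf.
have /choice[g gP] (A : set X) : exists xB : X * set X, infinite_set A ->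
    [/\ A xB.1, infinite_set xB.2, xB.2 `<=` A `\ xB.1 &
    forall y z, xB.2 y -> xB.2 z -> mdist xB.1 y = mdist xB.1 z].
  (* The value at a finite [A] is a dummy: the iteration meets only infinite sets. *)
  have [Afin|Ainf] := pselect (finite_set A); first by exists (x0, A).
  by have [xB ?] := infinite_sphere_inter _ Xfin Ainf; exists xB.
pose A n := iter n (fun A => (g A).2) [set: X].
pose s n := (g (A n)).1.
have Ainf n : infinite_set (A n).
  by elim: n => //= n /gP[].
have sA n : A n (s n) by have [] := gP _ (Ainf n).
have AS n : A n.+1 `<=` A n `\ s n by have [] := gP _ (Ainf n).
have sphere n y z : A n.+1 y -> A n.+1 z -> mdist (s n) y = mdist (s n) z.
  by have [_ _ _] := gP _ (Ainf n); apply.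
have Ale i j : (i <= j)%N -> A j `<=` A i.
  move=> /subnK <-; elim: (j - i)%N => // k IH y /AS[+ _]; exact: IH.
have sAlt i j : (i < j)%N -> A i.+1 (s j) by move=> /Ale; apply.
have sneq i j : (i < j)%N -> s j <> s i by move=> /sAlt/AS[].
exists s.
  move=> i j sij; case: (ltngtP i j) => // /sneq; rewrite sij //.
(* For [i < j], both [s i.+1] and [s j] lie in [A i.+1], hence on one sphere around [s i]. *)
exists (fun n => s n.+1); split=> [n|i j ij]; first exact/nesym/sneq.
by left; apply: sphere; exact: sAlt.
Qed.

End Partners.

Theorem proposition2p1 (R : realType) (X : metricType R)
    (Xinf : infinite_set [set: X]) (Xultra : ultrametric X) :
  exists Y : set X, [/\ countable Y, infinite_set Y &
    forall F : set_system X, free_ultrafilter F -> F Y -> metrically_Ramsey F].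
Proof.
have [s sinj [p sp]] : exists2 s : nat -> X, injective s & exists p, partners _ _ s p.
  have [Xfin|] := pselect (forall x : X, finite_set (range (mdist x))).
    exact: finite_distances_partners.
  by move=> /existsNP[x]; exact: infinite_distances_partners.
exists (range s); split; first exact: card_image_le.
  exact: range_infinite.
by move=> F [FU _]; exact: partners_Ramsey sp FU.
Qed.
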